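(* Let $n\ge 1$ and let $A_n$ be the $n$-th Adomian polynomial for the nonlinear term $N(u)$. Then $$A_n(u_0,u_1,\ldots,u_n)=\frac{1}{n!}\sum_{k=1}^{n}B_{n,k}\big(1!u_1,2!u_2,\ldots,(n-k+1)!u_{n-k+1}\big)\,N^{(k)}(u_0).$$
   Context: $N$ is a function of one variable, analytic near $u_0$, and $N^{(k)}$ denotes its $k$-th derivative. With $u_\lambda=\sum_{k=0}^{\infty}u_k\lambda^k$ (the series being assumed convergent and $N(u_\lambda)$ analytic in $\lambda$), the $n$-th Adomian polynomial of $N$ is $$A_n(u_0,\ldots,u_n)=\frac{1}{n!}\frac{\partial^n N(u_\lambda)}{\partial\lambda^n}\Big|_{\lambda=0},$$ equivalently $$A_n(u_0,\ldots,u_n)=\frac{1}{n!}\frac{\partial^n}{\partial\lambda^n}N\Big(\sum_{k=0}^{n}u_k\lambda^k\Big)\Big|_{\lambda=0}.$$ For $1\le k\le n$, the partial exponential Bell polynomial is $$B_{n,k}(x_1,\ldots,x_{n-k+1})=n!\sum_{\Lambda^k_n}\prod_{j=1}^{n-k+1}\frac{1}{k_j!}\Big(\frac{x_j}{j!}\Big)^{k_j},$$ where the sum is over $\Lambda^k_n=\{(k_1,\ldots,k_{n-k+1}): \sum_j k_j=k,\ \sum_j jk_j=n,\ k_j\in\mathbb{Z}_{\ge 0}\}$. *)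

(* Defs.v *)
From HB Require Import structures.
From mathcomp Require Import all_boot all_order all_algebra.
From mathcomp Require Import complex.
From mathcomp Require Import all_classical all_reals all_analysis.

Set Implicit Arguments.
Unset Strict Implicit.
Unset Printing Implicit Defensive.

Import Order.TTheory GRing.Theory Num.Theory.
Import numFieldNormedType.Exports.

Local Open Scope classical_set_scope.
Local Open Scope ring_scope.

(* The scalars are the real or the complex numbers.  Working over any complete
   Archimedean numFieldType covers both cases at once: see
   complete_archimedean_real and complete_archimedean_complex below. *)
Definition complete_archimedean (K : numFieldType) : Prop :=
  (forall x : K, exists m : nat, `|x| < m%:R) /\
  (forall F : set_system K, ProperFilter F -> cauchy F -> cvg F).

Definition analytic_at (K : numFieldType) (f : K -> K) (x0 : K) : Prop :=
  exists c : nat -> K,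
    \forall x \near x0, [series c k * (x - x0) ^+ k]_k @ \oo --> f x.

Definition usum (K : numFieldType) (u : nat -> K) (lam : K) : K :=
  limn [series u k * lam ^+ k]_k.

(* The whole sequence u is an argument, although the value only depends on
   u_0, ..., u_n; the version with the truncated sum is the instance where
   u k = 0 for all k > n. *)
Definition adomian (K : numFieldType) (N : K -> K) (n : nat) (u : nat -> K) : K :=
  (n`!%:R)^-1 * derive1n n (fun lam : K => N (usum u lam)) 0.

(* Only x 1, ..., x (n - k + 1) are used.  The exponents k_1, ..., k_(n-k+1) are
   kappa 0, ..., kappa (n - k); as they sum to k, each of them is at most k, so
   taking them in 'I_k.+1 loses nothing. *)
Definition bell (K : numFieldType) (n k : nat) (x : nat -> K) : K :=
  n`!%:R * \sum_(kappa : {ffun 'I_(n - k + 1) -> 'I_k.+1} |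
                 (\sum_(j < n - k + 1) kappa j == k)%N &&
                 (\sum_(j < n - k + 1) j.+1 * kappa j == n)%N)
             \prod_(j < n - k + 1)
               (((kappa j)`!%:R)^-1 * (x j.+1 / (j.+1)`!%:R) ^+ kappa j).

Lemma complete_archimedean_real (R : realType) : complete_archimedean R.
Proof.
split=> [x|F FF cF]; last exact: (@cauchy_cvg R F FF cF).
by exists (Num.bound `|x|); exact: archi_boundP.
Qed.

Lemma complete_archimedean_complex (R : realType) :
  complete_archimedean R[i].
Proof.
split=> [x|F FF cF].
  exists (Num.bound (Num.sqrt (complex.Re x ^+ 2 + complex.Im x ^+ 2))).
  rewrite normc_def -(rmorph_nat (real_complex R)) ltcR.
  by apply: le_lt_trans (archi_boundP _); rewrite ?sqrtr_ge0.
have cvg_part (p : R[i] -> R) :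
    (forall x y, p (x - y) = p x - p y) -> (forall x, (`|p x|)%:C%C <= `|x|) ->
  exists l : R, forall e : R, 0 < e -> F [set x | `|l - p x| < e].
  move=> pB ple.
  have cpF : cauchy (p @ F).
    apply/cauchyP => e e0; have /cauchyP cF' := cF.
    have [|x Fx] := cF' (e%:C%C); first by rewrite ltcR.
    exists (p x); apply: (@filterS _ F _ _ _ _ Fx) => y; rewrite -!ball_normE/= => xy.
    by rewrite -pB -ltcR (le_lt_trans (ple _)).
  have /cvg_ex[l pl] : cvg (p @ F) by exact: (@cauchy_cvg R (p @ F)).
  by exists l => e e0; move/cvgrPdist_lt : pl; exact.
have Im_le (x : R[i]) : (`|complex.Im x|)%:C%C <= `|x|.
  rewrite normc_def lecR -sqrtr_sqr ler_sqrt ?addr_ge0 ?sqr_ge0//.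
  by rewrite lerDr sqr_ge0.
have [a Fa] := cvg_part _ (@raddfB _ _ (@complex.Re R)) (@normc_ge_Re R).
have [b Fb] := cvg_part _ (@raddfB _ _ (@complex.Im R)) Im_le.
apply/cvg_ex; exists (a +i* b)%C; apply/cvgrPdist_lt => e e0.
have [d d0 ed] : exists2 d : R, 0 < d & d%:C%C = e.
  by exists (complex.Re e); rewrite ?RRe_real ?gtr0_real// -ltcR RRe_real ?gtr0_real.
have d20 : 0 < d / 2 by rewrite divr_gt0.
apply: filterS (filterI (Fa _ d20) (Fb _ d20)) => x [/= xa xb].
rewrite -ed normc_def ltcR/= -[ltRHS]gtr0_norm// -sqrtr_sqr ltr_sqrt ?exprn_gt0//.
case: x xa xb => x y /= xa xb.
rewrite -(real_normK (num_real (a - x))) -(real_normK (num_real (b - y))).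
have h : 0 <= d / 2 by exact: ltW.
apply: (@lt_le_trans _ _ ((d / 2) ^+ 2 + (d / 2) ^+ 2)).
  by rewrite ltrD// ltrXn2r.
rewrite -mulr2n -(mulr_natl (_ ^+ 2)) expr_div_n mulrCA ler_piMr ?sqr_ge0//.
by rewrite ler_pdivrMr ?exprn_gt0// mul1r -natrX ler_nat.
Qed.

(* Main.v *)
(* Both N near u_0 and lambda |-> N(u_lambda) near 0 are sums of power series,
   with coefficients c_k and d_k; termwise differentiation gives
   N^(k)(u_0) = k! c_k and A_n = d_n.  With P = u_1 X + ... + u_n X^n, one has
   u_lambda - u_0 = P(lambda) + O(lambda^(n+1)), so replacing N by its Taylor
   polynomial yields sum_(k<=n) d_k lambda^k = sum_(k<=n) c_k P(lambda)^k +
   O(lambda^(n+1)); a polynomial which is O(lambda^(n+1)) has no coefficients of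
   degree at most n, hence d_n is the sum of the c_k [X^n] P^k.  Finally
   k! B_(n,k)(1! u_1, 2! u_2, ...) = n! [X^n] P^k by the multinomial theorem. *)
Require Import Defs.
From mathcomp Require Import all_boot all_order all_algebra.
From mathcomp Require Import ring.
From mathcomp Require Import all_classical all_reals all_analysis.

Set Implicit Arguments.
Unset Strict Implicit.
Unset Printing Implicit Defensive.

Import Order.TTheory GRing.Theory Num.Theory.
Import numFieldNormedType.Exports.

Local Open Scope classical_set_scope.
Local Open Scope ring_scope.

(** * Bell polynomials as coefficients of powers of a polynomial *)

(** Only degrees up to j matter for the coefficient of X^j, so cutting exp(a_i X) at degree k >= j
    is harmless; the induction step is the binomial theorem divided by j!. Factorials are inverted
    in the scalar field [F], as [A] will be a polynomial ring. *)
Lemma coef_prod_exp_poly (F : numFieldType) (A : comAlgType F) (I : Type)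
    (s : seq I) (a : I -> A) (k j : nat) : (j <= k)%N ->
  (\prod_(i <- s) \poly_(l < k.+1) ((l`!%:R)^-1 *: a i ^+ l))`_j =
  (j`!%:R)^-1 *: (\sum_(i <- s) a i) ^+ j.
Proof.
elim: s j => [|i s IHs] j jk.
  rewrite !big_nil coef1 expr0n; case: eqP => [->|_]; last by rewrite scaler0.
  by rewrite fact0 invr1 scale1r.
rewrite !big_cons coefMr exprDn scaler_sumr; apply: eq_bigr => l _.
have lj : (l <= j)%N by rewrite -ltnS.
rewrite coef_poly ltnS (leq_trans (leq_subr _ _) jk) IHs ?(leq_trans lj)//.
rewrite -scalerAl -scalerAr scalerA -[X in _ = _ *: X]scaler_nat scalerA; congr (_ *: _).
rewrite -(bin_fact lj) !natrM !invfM.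
have nz m : (m`!)%:R != 0 :> F by rewrite pnatr_eq0 -lt0n fact_gt0.
by rewrite mulrC mulrAC mulVf ?mul1r ?pnatr_eq0 -?lt0n ?bin_gt0.
Qed.

(* Compare the coefficients of 'X^k in the product of the truncated exponentials
   exp(a_i 'X), computed as an exponential and by distributing. *)
Lemma multinomial_expand (F : numFieldType) (A : comAlgType F) (m k : nat)
    (a : 'I_m -> A) :
  (\sum_(i < m) a i) ^+ k =
  k`!%:R *: \sum_(kappa : {ffun 'I_m -> 'I_k.+1} |
                  (\sum_(i < m) kappa i == k)%N)
             \prod_(i < m) (((kappa i)`!%:R)^-1 *: a i ^+ kappa i).
Proof.
have nz : (k`!)%:R != 0 :> F by rewrite pnatr_eq0 -lt0n fact_gt0.
apply: (canRL (scalerKV nz)).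
rewrite -(@coef_prod_exp_poly _ _ _ (index_enum 'I_m) a k k)//.
under eq_bigr do rewrite poly_def.
rewrite bigA_distr_bigA /=.
under eq_bigr do rewrite scaler_prod prodrXr.
by rewrite coef_sumMXn; apply: eq_bigl.
Qed.

(** The difference of the k-th powers is X^m r times a sum of products of k - 1 factors, each
    divisible by X; hence X^(m+k-1) divides it. *)
Lemma coef_exprB_low (R : comNzRingType) (p q r : {poly R}) (m k : nat) :
  'X * p - 'X * q = 'X^m * r ->
  forall i, (i + 1 < m + k)%N -> (('X * p) ^+ k)`_i = (('X * q) ^+ k)`_i.
Proof.
move=> pq i im; apply/eqP; rewrite -subr_eq0 -coefB subrXX pq.
case: k im => [|k] im; first by rewrite big_ord0 mulr0 coef0.
suff -> : \sum_(l < k.+1) ('X * p) ^+ (k.+1.-1 - l) * ('X * q) ^+ l =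
    'X^k * \sum_(l < k.+1) p ^+ (k - l) * q ^+ l.
  by rewrite mulrACA -exprD coefXnM ifT// -ltnS -addn1 (leq_trans im)// addnS.
rewrite mulr_sumr; apply: eq_bigr => l _.
by rewrite !exprMn mulrACA -exprD subnK// -ltnS.
Qed.

Lemma bell_coef (K : numFieldType) (u : nat -> K) (n k : nat) :
  (1 <= k <= n)%N ->
  bell n k (fun j => j`!%:R * u j) * k`!%:R =
  n`!%:R * ((\sum_(1 <= j < n.+1) u j *: 'X^j) ^+ k)`_n.
Proof.
move=> /andP[k0 kn]; rewrite /bell -mulrA; congr (_ * _).
(* Only u_1, ..., u_(n-k+1) contribute to the coefficient of 'X^n in the k-th
   power of a polynomial without constant term. *)
pose P m := \sum_(i < m) u i.+1 *: 'X^i : {poly K}.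
have PE m : \sum_(i < m) u i.+1 *: 'X^(i.+1) = 'X * P m.
  by rewrite mulr_sumr; apply: eq_bigr => i _; rewrite -scalerAr -exprS.
have -> : \sum_(1 <= j < n.+1) u j *: 'X^j = 'X * P n.
  by rewrite -PE big_add1 big_mkord.
have Pn : 'X * P n - 'X * P (n - k + 1)%N =
    'X^(n - k + 2) * \sum_(n - k + 1 <= i < n) u i.+1 *: 'X^(i - (n - k + 1)).
  rewrite -mulrBr /P -!(big_mkord xpredT (fun i => u i.+1 *: 'X^i)).
  rewrite (@big_cat_nat _ _ _ (n - k + 1)%N) //=; last first.
    by rewrite addn1 ltn_subrL k0 (leq_trans k0 kn).
  rewrite addrAC subrr add0r addn2 exprS -mulrA -(addn1 (n - k)); congr (_ * _).
  rewrite mulr_sumr.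
  apply: eq_big_nat => i /andP[ni _].
  by rewrite -scalerAr -exprD subnKC.
rewrite (coef_exprB_low Pn); last by rewrite addnAC subnK// addn1 addn2.
rewrite -PE multinomial_expand coefZ coef_sum mulrC; congr (_ * _).
(* The weight condition sum_j j k_j = n becomes an indicator, which is the coefficient of X^n in the
   monomial X^(sum_j j k_j). *)
rewrite big_mkcondr/=; apply: eq_bigr => kap _.
rewrite [in RHS]scaler_prod coefZ.
under [X in _ * (polyseq X)`__]eq_bigr do rewrite exprZn -exprM.
rewrite [in RHS]scaler_prod coefZ prodrXr coefXn eq_sym mulrA mulr_natr -big_split/=.
case: eqP => _; rewrite ?mulr1n ?mulr0n//.
apply: eq_bigr => j _; rewrite [_ * u _]mulrC mulfK//.
Qed.

(** * Limits and geometric series over a complete Archimedean field *)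

Lemma norm_lim_le (K : numFieldType) (s : nat -> K) (l B : K) :
  s @ \oo --> l -> (forall n, `|s n| <= B) -> `|l| <= B.
Proof.
move=> /cvgrPdist_lt sl sB.
(* The order of [K] is only partial; B dominates a norm, hence is real and comparable with |l|. *)
have Br : B \is Num.real by rewrite ger0_real// (le_trans _ (sB 0%N)).
rewrite real_leNgt//; apply/negP => Bl.
have /sl[m _ /(_ m (leqnn m))] : 0 < `|l| - B by rewrite subr_gt0.
rewrite ltrBrDl => lB.
suff : `|l| < `|l| by rewrite ltxx.
apply: le_lt_trans lB; rewrite -{1}(subrK (s m) l) addrC.
by apply: le_trans (ler_normD _ _) _; rewrite lerD2r.
Qed.

Lemma geometric_le (K : numFieldType) (q : K) (m n : nat) : 0 <= q -> q < 1 ->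
  \sum_(m <= k < n) q ^+ k <= q ^+ m / (1 - q).
Proof.
move=> q0 q1; have q1' : 0 < 1 - q by rewrite subr_gt0.
rewrite ler_pdivlMr//.
have [nm|/ltnW mn] := leqP n m; first by rewrite big_geq// mul0r exprn_ge0.
rewrite mulr_suml (eq_bigr (fun k => - (q ^+ k.+1 - q ^+ k))); last first.
  by move=> k _; rewrite mulrBr mulr1 -exprSr opprB.
by rewrite sumrN telescope_sumr// opprB gerBl exprn_ge0.
Qed.

(** For m > 1/((1 - q) e), one has m q^m <= 1 + q + ... + q^(m-1) <= 1/(1 - q) < m e. *)
Lemma geometric_null (K : numFieldType) (q e : K) : complete_archimedean K ->
  0 <= q -> q < 1 -> 0 < e -> exists m, q ^+ m < e.
Proof.
move=> [arch _] q0 q1 e0; have q1' : 0 < 1 - q by rewrite subr_gt0.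
have [m] := arch ((1 - q)^-1 / e).
have me0 : 0 < (1 - q)^-1 / e by rewrite divr_gt0 ?invr_gt0.
rewrite gtr0_norm// ltr_pdivrMr// => me.
have m0 : 0 < m%:R :> K.
  rewrite ltr0n lt0n; apply/eqP => m0; move: me.
  by rewrite m0 mul0r le_gtF// invr_ge0 ltW.
exists m; rewrite -(ltr_pM2l m0); apply: le_lt_trans me.
have := @geometric_le K q 0 m q0 q1; rewrite expr0 mul1r; apply: le_trans.
rewrite mulr_natl -[X in _ *+ X]subn0 -sumr_const_nat; apply: ler_sum_nat.
by move=> i /andP[_ im]; exact: (ler_wiXn2l q0 (ltW q1) (ltnW im)).
Qed.

Lemma cvg_series_geometric (K : numFieldType) (a : nat -> K) (M q : K) :
  complete_archimedean K -> 0 <= q -> q < 1 ->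
  (forall k, `|a k| <= M * q ^+ k) -> cvgn (series a).
Proof.
move=> hK q0 q1 aM; have q1' : 0 < 1 - q by rewrite subr_gt0.
have M0 : 0 <= M by have := aM 0%N; rewrite expr0 mulr1; apply: le_trans.
apply: hK.2; apply/cauchyP => e e0.
(* The tail from m on is at most M q^m / (1 - q); dividing by M + 1 instead of M covers M = 0. *)
have [|m qm] := @geometric_null K q (e * (1 - q) / (M + 1)) hK q0 q1.
  by rewrite divr_gt0 ?mulr_gt0// ltr_wpDl.
exists (series a m); exists m => // n /= mn.
rewrite -ball_normE/= distrC sub_series_geq//.
apply: le_lt_trans (ler_norm_sum _ _ _) _.
apply: (@le_lt_trans _ _ (\sum_(m <= k < n) M * q ^+ k)).
  by apply: ler_sum => k _; exact: aM.
rewrite -mulr_sumr; apply: (@le_lt_trans _ _ (M * (q ^+ m / (1 - q)))).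
  by rewrite ler_wpM2l// geometric_le.
move: qm; rewrite ltr_pdivlMr ?ltr_wpDl// mulrA ltr_pdivrMr//; apply: le_lt_trans.
by rewrite mulrC ler_wpM2l ?exprn_ge0// lerDl.
Qed.

(** * Power series: coefficient bounds, termwise differentiation, Taylor remainder *)

(** Convergence at the single point x0 + r makes the terms c_k r^k tend to 0, so they are bounded.
    This allows comparison with a geometric series of ratio |x - x0| / r inside the disc. *)
Lemma power_series_bound (K : numFieldType) (c : nat -> K) (f : K -> K) (x0 : K) :
  (\forall x \near x0, [series c k * (x - x0) ^+ k]_k @ \oo --> f x) ->
  exists r M : K, [/\ 0 < r, 0 <= M, forall k, `|c k| * r ^+ k <= M &
    forall x, `|x - x0| < r -> [series c k * (x - x0) ^+ k]_k @ \oo --> f x].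
Proof.
move=> /nbhs_ballP[e /= e0 ef]; pose r := e / 2.
have r0 : 0 < r by rewrite divr_gt0.
have re : r < e by rewrite ltr_pdivrMr// ltr_pMr// ltr1n.
have /cvgP/cvg_series_cvg_0/cvgP/cvg_seq_bounded :
    [series c k * (x0 + r - x0) ^+ k]_k @ \oo --> f (x0 + r).
  by apply: ef; rewrite -ball_normE/= opprD addNKr normrN gtr0_norm.
move=> /(ex_bound _ (PF := globally_properfilter (I : setT 0%N)))[M cM].
exists r, M.
have cM' k : `|c k| * r ^+ k <= M.
  rewrite -[r ^+ k]gtr0_norm ?exprn_gt0// -normrM.
  by have := cM k I; rewrite addrC addKr.
split => //.
  by apply: le_trans (cM' 0%N); rewrite expr0 mulr1.
move=> x xr; apply: ef; rewrite -ball_normE/= distrC.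
exact: lt_trans re.
Qed.

(* The second-order remainders at (y, h) and at (|y|, d) obey the same recurrence
   in k, so no binomial expansion is needed.  As the latter is at most
   (|y| + d)^k, the bound is summable against the coefficients of a power series
   inside its disc of convergence. *)
Lemma expr_taylor1_le (K : numFieldType) (y h d : K) (k : nat) :
  0 <= d -> `|h| <= d ->
  `|(y + h) ^+ k - y ^+ k - k%:R * y ^+ k.-1 * h| * d ^+ 2 <=
  `|h| ^+ 2 * ((`|y| + d) ^+ k - `|y| ^+ k - k%:R * `|y| ^+ k.-1 * d).
Proof.
move=> d0 hd.
have step (a b : K) m : (a + b) ^+ m.+1 - a ^+ m.+1 - m.+1%:R * a ^+ m * b =
    (a + b) * ((a + b) ^+ m - a ^+ m - m%:R * a ^+ m.-1 * b) +
    m%:R * a ^+ m.-1 * b ^+ 2.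
  case: m => [|m] /=; first by rewrite !(expr0, expr1); ring.
  by rewrite -!natr1 !exprS; ring.
elim: k => [|k IHk]; first by rewrite !expr0 !mul0r !subrr !(normr0, mul0r, mulr0, subr0).
rewrite !step [leRHS]mulrDr.
apply: le_trans (ler_wpM2r (exprn_ge0 _ d0) (ler_normD _ _)) _.
rewrite mulrDl lerD//.
  rewrite normrM -mulrA [leRHS]mulrCA ler_pM ?mulr_ge0 ?exprn_ge0//.
  by apply: le_trans (ler_normD _ _) _; rewrite lerD2l.
by rewrite !normrM normr_nat !normrX le_eqVlt; apply/predU1l; ring.
Qed.

(** Taking h = d in [expr_taylor1_le] shows that the second-order remainder of (a + d)^k is
    nonnegative, so (a + d)^k dominates its linear term. *)
Lemma nat_expr_le (K : numFieldType) (a d : K) (k : nat) : 0 <= a -> 0 < d ->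
  k%:R * a ^+ k.-1 * d <= (a + d) ^+ k.
Proof.
move=> a0 d0; have d20 : 0 < `|d| ^+ 2 by rewrite gtr0_norm// exprn_gt0.
have dd : `|d| <= d by rewrite gtr0_norm.
have := expr_taylor1_le a k (ltW d0) dd.
rewrite [`|a|]ger0_norm// => /(le_trans _)/=.
move=> /(_ 0); rewrite mulr_ge0 ?exprn_ge0 ?(ltW d0)// => /(_ isT).
rewrite pmulr_rge0// subr_ge0 => /le_trans; apply.
by rewrite gerBl exprn_ge0.
Qed.

(** Summing the termwise second-order remainders gives |f(x + h) - f(x) - S h| <= C |h|^2, where S
    is the sum of the derived series. The conclusion holds on a neighbourhood so that it can be
    iterated. *)
Lemma derive1_power_series (K : numFieldType) (c : nat -> K) (f : K -> K) (x0 : K) :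
  complete_archimedean K ->
  (\forall x \near x0, [series c k * (x - x0) ^+ k]_k @ \oo --> f x) ->
  \forall x \near x0,
    [series k.+1%:R * c k.+1 * (x - x0) ^+ k]_k @ \oo --> derive1 f x.
Proof.
move=> hK /power_series_bound[r [M [r0 M0 cM cf]]].
apply/nbhs_ballP; exists r => //= x; rewrite -ball_normE/= distrC.
set y := x - x0 => yr.
(* d is half the distance from y to the boundary of the disc, so |y| + d < r and q < 1. *)
pose d := (r - `|y|) / 2; pose q := (`|y| + d) / r.
have d0 : 0 < d by rewrite divr_gt0// subr_gt0.
have yd0 : 0 <= `|y| + d by rewrite addr_ge0// ltW.
have ydr : `|y| + d < r.
  by rewrite addrC -ltrBrDr /d ltr_pdivrMr// ltr_pMr ?subr_gt0// ltr1n.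
clearbody d.
have q0 : 0 <= q by rewrite divr_ge0// ltW.
have q1 : q < 1 by rewrite ltr_pdivrMr// mul1r.
have q1' : 0 < 1 - q by rewrite subr_gt0.
have cq k : `|c k| * (`|y| + d) ^+ k <= M * q ^+ k.
  rewrite -[_ + d](divfK (lt0r_neq0 r0)) -/q exprMn mulrCA mulrC.
  by rewrite ler_wpM2r// exprn_ge0.
have /cvg_ex[S bS] : cvgn (series (fun k => k.+1%:R * c k.+1 * y ^+ k)).
  apply: (@cvg_series_geometric _ _ (M * q / d) q) => // k.
  rewrite [leRHS]mulrAC ler_pdivlMr// !normrM normr_nat normrX -[M * q * _]mulrA -exprS.
  apply: le_trans (cq k.+1).
  rewrite [_ * `|c _|]mulrC -!mulrA ler_wpM2l// mulrA.
  exact: nat_expr_le.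
(* The term of index 0 vanishes, so this is the derived series shifted by one, now indexed like the
   series of f. *)
have kS : series (fun k => k%:R * c k * y ^+ k.-1) @ \oo --> S.
  rewrite -cvg_shiftS; apply: cvg_trans bS; apply: near_eq_cvg.
  near=> n; rewrite /series/= big_nat_recl// !mul0r add0r.
  by apply: eq_bigr.
have diff h : `|h| < d -> `|f (h + x) - f x - S * h| <= M / (1 - q) / d ^+ 2 * `|h| ^+ 2.
  move=> hd.
  have fh : series (fun k => c k * (y + h) ^+ k) @ \oo --> f (h + x).
    have -> : y + h = h + x - x0 by rewrite /y; ring.
    apply: cf; rewrite -addrA -/y; apply: le_lt_trans (ler_normD _ _) _.
    by apply: lt_trans ydr; rewrite addrC ltrD2l.
  have lim := cvgB (cvgB fh (cf _ yr)) (cvgM kS (cvg_cst h)).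
  apply: (norm_lim_le (lim _ _ _ _)) => n.
  rewrite !fctE.
  have d20 : 0 < d ^+ 2 by rewrite exprn_gt0.
  rewrite mulrAC ler_pdivlMr// /series/= mulr_suml -!sumrB.
  apply: le_trans (ler_wpM2r (ltW d20) (ler_norm_sum _ _ _)) _.
  rewrite mulr_suml [leRHS]mulrC.
  apply: (@le_trans _ _ (\sum_(0 <= k < n) `|h| ^+ 2 * (M * q ^+ k))).
    apply: ler_sum => k _.
    have -> : c k * (y + h) ^+ k - c k * y ^+ k - k%:R * c k * y ^+ k.-1 * h =
              c k * ((y + h) ^+ k - y ^+ k - k%:R * y ^+ k.-1 * h) by ring.
    rewrite normrM -mulrA.
    apply: le_trans (ler_wpM2l (normr_ge0 _) (expr_taylor1_le y k (ltW d0) (ltW hd))) _.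
    rewrite mulrCA ler_wpM2l ?exprn_ge0//; apply: le_trans (cq k).
    rewrite ler_wpM2l// -addrA -opprD gerBl.
    by rewrite addr_ge0 ?mulr_ge0 ?exprn_ge0 ?ler0n ?normr_ge0 ?(ltW d0).
  rewrite -!mulr_sumr ler_wpM2l ?exprn_ge0// ler_wpM2l//.
  by have := @geometric_le K q 0 n q0 q1; rewrite expr0 mul1r.
suff -> : derive1 f x = S by [].
apply: cvg_lim; first exact: norm_hausdorff.
apply/cvgrPdist_le => e e0.
set C := M / (1 - q) / d ^+ 2 in diff.
have C0 : 0 <= C by rewrite !divr_ge0 ?exprn_ge0// ltW.
(* Then |h| <= e / (C + 1) gives C |h| <= e, also when C = 0. *)
have eC : 0 < e / (C + 1) by rewrite divr_gt0// ltr_wpDl.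
near=> h.
have h0 : h != 0 by near: h; exact: nbhs_dnbhs_neq.
have hd : `|h| < d by near: h; apply: dnbhs0_lt.
have he : `|h| <= e / (C + 1) by near: h; apply: dnbhs0_le.
have hn : 0 < `|h| by rewrite normr_gt0.
rewrite distrC -(ler_pM2l hn) -normrM mulrBr /GRing.scale/= mulrA mulfV// mul1r.
rewrite [h * S]mulrC; apply: le_trans (diff h hd) _.
rewrite expr2 mulrCA ler_wpM2l//.
move: he; rewrite ler_pdivlMr ?ltr_wpDl//; apply: le_trans.
by rewrite mulrC ler_wpM2l// lerDl.
Unshelve. all: end_near.
Qed.

Lemma derive1n_power_series (K : numFieldType) (c : nat -> K) (f : K -> K)
    (x0 : K) (n : nat) : complete_archimedean K ->
  (\forall x \near x0, [series c k * (x - x0) ^+ k]_k @ \oo --> f x) ->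
  derive1n n f x0 = n`!%:R * c n.
Proof.
move=> hK; elim: n c f => [|n IHn] c f cf.
  rewrite fact0 mul1r /=; have := nbhs_singleton cf; rewrite subrr -cvg_shiftS => fc.
  have hs := @norm_hausdorff K K.
  rewrite -(cvg_lim hs fc); apply: (cvg_lim hs).
  have c0 : (fun _ : nat => c 0%N) @ \oo --> c 0%N by exact: cvg_cst.
  apply: cvg_trans c0; apply: near_eq_cvg; near=> m.
  rewrite /series/= big_nat_recl// expr0 mulr1 big1_seq ?addr0// => i _.
  by rewrite expr0n mulr0.
(* The inner derivative is taken first: the induction hypothesis for the coefficients (k + 1)
   c_(k+1) gives n! (n + 1) c_(n+1). *)
rewrite derive1Sn (IHn _ _ (derive1_power_series hK cf)).
by rewrite mulrA -natrM mulnC factS.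
Unshelve. all: end_near.
Qed.

(** On the disc of radius r/2 the ratio q = |x - x0| / r is below 1/2, so the tail from n on is at
    most M q^n / (1 - q) <= 2 M q^n. *)
Lemma power_series_remainder (K : numFieldType) (c : nat -> K) (f : K -> K)
    (x0 : K) (n : nat) :
  (\forall x \near x0, [series c k * (x - x0) ^+ k]_k @ \oo --> f x) ->
  exists2 C : K, 0 <= C & \forall x \near x0,
    `|f x - \sum_(k < n) c k * (x - x0) ^+ k| <= C * `|x - x0| ^+ n.
Proof.
move=> /power_series_bound[r [M [r0 M0 cM cf]]].
exists (M * 2 / r ^+ n); first by rewrite divr_ge0 ?mulr_ge0 ?exprn_ge0// ltW.
have r20 : 0 < r / 2 by rewrite divr_gt0.
apply/nbhs_ballP; exists (r / 2) => //= x; rewrite -ball_normE/= distrC => xr.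
have /cf fx : `|x - x0| < r.
  by rewrite (lt_trans xr)// ltr_pdivrMr// ltr_pMr// ltr1n.
set y := x - x0 in xr fx *; pose q := `|y| / r.
have q0 : 0 <= q by rewrite divr_ge0// ltW.
have q2 : q < 2^-1 by rewrite ltr_pdivrMr// mulrC.
have q1 : q < 1 by rewrite (lt_trans q2)// invf_lt1// ltr1n.
have yq : `|y| = q * r by rewrite divfK// gt_eqF.
have := cvgB fx (cvg_cst (\sum_(k < n) c k * y ^+ k)).
(* After the shift every partial sum contains the first n terms, and subtracting them leaves a
   tail. *)
rewrite -(cvg_shiftn n) => /(_ _ _)/norm_lim_le; apply => m.
rewrite !fctE -(big_mkord xpredT (fun k => c k * y ^+ k)).
rewrite [X in `|X|](_ : _ = \sum_(n <= k < m + n) c k * y ^+ k); last first.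
  exact: (sub_series_geq (fun k => c k * y ^+ k) (leq_addl m n)).
apply: le_trans (ler_norm_sum _ _ _) _.
apply: (@le_trans _ _ (\sum_(n <= k < m + n) M * q ^+ k)).
  apply: ler_sum => k _; rewrite normrM normrX yq exprMn mulrCA mulrC.
  by rewrite ler_wpM2r ?exprn_ge0//.
rewrite -mulr_sumr -!mulrA ler_wpM2l//.
apply: le_trans (geometric_le _ _ q0 q1) _.
rewrite [(r ^+ n)^-1 * _]mulrC -expr_div_n -/q mulrC ler_wpM2r ?exprn_ge0//.
rewrite -[leRHS]invrK lef_pV2 ?posrE ?invr_gt0 ?subr_gt0//.
by rewrite lerBrDr [leRHS]splitr div1r lerD2l ltW.
Qed.

(** * Calculus of O(x^m) at the origin *)

Definition near0_bigO (K : numFieldType) (m : nat) (g : K -> K) : Prop :=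
  exists2 C : K, 0 <= C & \forall x \near (0 : K), `|g x| <= C * `|x| ^+ m.

Lemma near0_bigO_eq (K : numFieldType) (m : nat) (f g : K -> K) :
  (\forall x \near (0 : K), f x = g x) ->
  near0_bigO m f -> near0_bigO m g.
Proof.
move=> fg [C C0 fC]; exists C => //; near=> x.
rewrite -(_ : f x = g x); first by near: x.
by near: x.
Unshelve. all: end_near.
Qed.

Lemma near0_bigOD (K : numFieldType) (m : nat) (f g : K -> K) :
  near0_bigO m f -> near0_bigO m g ->
  near0_bigO m (fun x => f x + g x).
Proof.
move=> [C C0 fC] [D D0 gD]; exists (C + D); first exact: addr_ge0.
near=> x; apply: le_trans (ler_normD _ _) _; rewrite mulrDl lerD//; near: x.
- exact: fC.
- exact: gD.
Unshelve. all: end_near.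
Qed.

Lemma near0_bigOM (K : numFieldType) (m p : nat) (f g : K -> K) :
  near0_bigO m f -> near0_bigO p g ->
  near0_bigO (m + p) (fun x => f x * g x).
Proof.
move=> [C C0 fC] [D D0 gD]; exists (C * D); first exact: mulr_ge0.
near=> x; rewrite normrM exprD mulrACA ler_pM//; near: x.
- exact: fC.
- exact: gD.
Unshelve. all: end_near.
Qed.

Lemma near0_bigO_cst (K : numFieldType) (a : K) : near0_bigO 0 (fun=> a).
Proof. by exists `|a| => //; near=> x; rewrite expr0 mulr1. Unshelve. all: end_near. Qed.

Lemma near0_bigOX (K : numFieldType) (m : nat) : near0_bigO m (fun x : K => x ^+ m).
Proof. by exists 1 => //; near=> x; rewrite mul1r normrX. Unshelve. all: end_near. Qed.

Lemma near0_bigOZ (K : numFieldType) (m : nat) (a : K) (f : K -> K) :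
  near0_bigO m f -> near0_bigO m (fun x => a * f x).
Proof. exact: (near0_bigOM (near0_bigO_cst a)). Qed.

Lemma near0_bigO_sum (K : numFieldType) (m n : nat) (F : nat -> K -> K) :
  (forall k, near0_bigO m (F k)) -> near0_bigO m (fun x => \sum_(k < n) F k x).
Proof.
move=> FO; elim: n => [|n IHn].
  by exists 0 => //; near=> x; rewrite big_ord0 normr0 mul0r.
apply: near0_bigO_eq (near0_bigOD IHn (FO n)).
by near=> x; rewrite big_ord_recr.
Unshelve. all: end_near.
Qed.

Lemma near0_bigO_le (K : numFieldType) (m p : nat) (f : K -> K) :
  (p <= m)%N -> near0_bigO m f -> near0_bigO p f.
Proof.
move=> pm [C C0 fC]; exists C => //; near=> x.
apply: (@le_trans _ _ (C * `|x| ^+ m)); first by near: x.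
have x1 : `|x| < 1 by near: x; exact: (@nbhs0_lt K K 1 ltr01).
by rewrite ler_wpM2l// (ler_wiXn2l _ (ltW x1) pm).
Unshelve. all: end_near.
Qed.

Lemma near0_bigO_horner (K : numFieldType) (p : {poly K}) : near0_bigO 0 (horner p).
Proof.
elim/poly_ind: p => [|p a IHp].
  by apply: near0_bigO_eq (near0_bigO_cst 0); near=> x; rewrite horner0.
have XO := near0_bigO_le (leq0n 1) (near0_bigOX K 1).
apply: near0_bigO_eq (near0_bigOD (near0_bigOM IHp XO) (near0_bigO_cst a)).
near=> x.
by rewrite hornerMXaddC expr1.
Unshelve. all: end_near.
Qed.

(** Induction on f^(k+1) - g^(k+1) = f (f^k - g^k) + g^k (f - g), with f and g bounded near 0. *)
Lemma near0_bigO_exprB (K : numFieldType) (m k : nat) (f g : K -> K) :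
  near0_bigO 0 f -> near0_bigO 0 g ->
  near0_bigO m (fun x => f x - g x) ->
  near0_bigO m (fun x => f x ^+ k - g x ^+ k).
Proof.
move=> fO gO fgO.
have gXO j : near0_bigO 0 (fun x => g x ^+ j).
  elim: j => [|j IHj]; first by under eq_fun do rewrite expr0; exact: near0_bigO_cst.
  by under eq_fun do rewrite exprS; exact: near0_bigOM gO IHj.
elim: k => [|k IHk].
  apply: near0_bigO_eq (near0_bigOZ 0 (near0_bigOX K m)); near=> x.
  by rewrite mul0r !expr0 subrr.
apply: near0_bigO_eq (near0_bigOD (near0_bigOM fO IHk) (near0_bigOM (gXO k) fgO)).
by near=> x; rewrite !exprS; ring.
Unshelve. all: end_near.
Qed.

Lemma near0_bigO_monomial (K : numFieldType) (i : nat) (a : K) :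
  near0_bigO i.+1 (fun x => a * x ^+ i) -> a = 0.
Proof.
move=> [C C0 aC]; apply/eqP; apply: contraT => a0.
have /nbhs_ballP[e /= e0 eC] := aC.
have ap : 0 < `|a| by rewrite normr_gt0.
have C10 : 0 < C + 1 by rewrite ltr_wpDl.
(* This t is less than both e and |a| / (C + 1), so the bound at t would give |a| <= C t < |a|. *)
pose t := e / 2 * (`|a| / (`|a| + e * (C + 1))).
have D0 : 0 < `|a| + e * (C + 1) by rewrite addr_gt0// mulr_gt0.
have t0 : 0 < t by rewrite mulr_gt0// divr_gt0.
have te : t < e.
  rewrite /t -mulrA gtr_pMr// mulrC.
  rewrite ltr_pdivrMr// (@lt_trans _ _ 1)// ?mul1r ?ltr1n// ltr_pdivrMr// mul1r.
  by rewrite ltrDl mulr_gt0.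
have : `|a * t ^+ i| <= C * `|t| ^+ i.+1.
  by apply: eC; rewrite -ball_normE/= sub0r normrN gtr0_norm.
rewrite normrM normrX (gtr0_norm t0) exprSr mulrA [leRHS]mulrAC ler_pM2r ?exprn_gt0//.
move=> aCt; have : C * t < `|a|.
  rewrite /t mulrA mulrA ltr_pdivrMr// mulrC ltr_pM2l//.
  apply: (@lt_le_trans _ _ (e * (C + 1))); last by rewrite lerDr ltW.
  rewrite mulrCA ltr_pM2l//.
  apply: (@le_lt_trans _ _ C); last by rewrite ltrDl.
  by rewrite ler_piMr// invf_le1// ler1n.
by move=> /(le_lt_trans aCt); rewrite ltxx.
Qed.

(** Once the coefficients below i vanish, p_i x^i is p(x) minus a multiple of x^(i+1), hence
    O(x^(i+1)), which forces p_i = 0. *)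
Lemma near0_bigO_coef (K : numFieldType) (m : nat) (p : {poly K}) :
  near0_bigO m (horner p) -> forall i, (i < m)%N -> p`_i = 0.
Proof.
move=> pO; elim/ltn_ind => i IHi im.
apply: (@near0_bigO_monomial K i).
have pE x : p`_i * x ^+ i = p.[x] - x ^+ i.+1 * (drop_poly i.+1 p).[x].
  rewrite -{2}(poly_take_drop i.+1 p) hornerD hornerM hornerXn [_.[x] * _]mulrC addrK.
  rewrite /take_poly horner_poly big_ord_recr/= big1 ?add0r// => j _.
  by rewrite IHi ?mul0r// (ltn_trans _ im).
under eq_fun do rewrite pE -mulN1r.
apply: near0_bigOD; first exact: near0_bigO_le im pO.
apply: near0_bigOZ; rewrite -[i.+1]addn0.
by apply: near0_bigOM (near0_bigO_horner _); rewrite addn0; exact: near0_bigOX.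
Qed.

(** * Coefficients of a composite power series, and the formula for A_n *)

Lemma near0_bigO_comp_taylor (K : numFieldType) (f v : K -> K) (c : nat -> K)
    (x0 : K) (n : nat) :
  (\forall x \near x0, [series c k * (x - x0) ^+ k]_k @ \oo --> f x) ->
  near0_bigO 1 (fun x => v x - x0) ->
  near0_bigO n (fun x => f (v x) - \sum_(k < n) c k * (v x - x0) ^+ k).
Proof.
move=> /(power_series_remainder n)[C C0 /nbhs_ballP[e /= e0 eC]] [D D0 vD].
have D10 : 0 < D + 1 by rewrite ltr_wpDl.
exists (C * D ^+ n); first by rewrite mulr_ge0 ?exprn_ge0.
near=> x; have vx : `|v x - x0| <= D * `|x| by rewrite -[`|x|]expr1; near: x.
(* This keeps v(x) within e of x0, where the Taylor remainder of f is controlled. *)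
have xe : `|x| < e / (D + 1) by near: x; exact: (@nbhs0_lt K K _ (divr_gt0 e0 D10)).
apply: le_trans (eC (v x) _) _.
  rewrite -ball_normE/= distrC; apply: le_lt_trans vx _.
  move: xe; rewrite ltr_pdivlMr//; apply: le_lt_trans.
  by rewrite mulrC ler_wpM2l// lerDl.
by rewrite -mulrA -exprMn ler_wpM2l// lerXn2r// nnegrE mulr_ge0.
Unshelve. all: end_near.
Qed.

Lemma coef_comp_power_series (K : numFieldType) (f v : K -> K) (c d u : nat -> K)
    (n : nat) :
  (\forall x \near u 0%N, [series c k * (x - u 0%N) ^+ k]_k @ \oo --> f x) ->
  (\forall x \near (0 : K), [series u k * x ^+ k]_k @ \oo --> v x) ->
  (\forall x \near (0 : K), [series d k * x ^+ k]_k @ \oo --> f (v x)) ->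
  d n = \sum_(k < n.+1) c k * ((\sum_(1 <= j < n.+1) u j *: 'X^j) ^+ k)`_n.
Proof.
move=> fc vu fvd.
set P : {poly K} := \sum_(1 <= j < n.+1) u j *: 'X^j.
have PE x : P.[x] = \sum_(k < n.+1) u k * x ^+ k - u 0%N.
  rewrite -(big_mkord xpredT (fun k => u k * x ^+ k)) big_nat_recl// mulr1.
  rewrite addrAC subrr add0r /P big_add1 horner_sum.
  by apply: eq_bigr => j _; rewrite hornerZ hornerXn.
clearbody P; have rem (a : nat -> K) (g : K -> K) m :
    (\forall x \near (0 : K), [series a k * x ^+ k]_k @ \oo --> g x) ->
    near0_bigO m (fun x => g x - \sum_(k < m) a k * x ^+ k).
  move=> ag; have [|C C0 gC] := @power_series_remainder _ a g 0 m.
    by apply: filterS ag => x; rewrite subr0.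
  by exists C => //; apply: filterS gC => x; rewrite subr0.
have v1 : near0_bigO 1 (fun x => v x - u 0%N).
  apply: near0_bigO_eq (rem _ _ 1 vu); near=> x.
  by rewrite big_ord1 mulr1.
pose Q : {poly K} := \sum_(k < n.+1) d k *: 'X^k - \sum_(k < n.+1) c k *: P ^+ k.
have QO : near0_bigO n.+1 (horner Q).
  (* Three errors add up to Q: the remainder of the expansion of the composite, the Taylor remainder
     of f at v(x), and the replacement of v(x) - u_0 by P(x). *)
  have QE x : - 1 * (f (v x) - \sum_(k < n.+1) d k * x ^+ k) +
      (f (v x) - \sum_(k < n.+1) c k * (v x - u 0%N) ^+ k) +
      \sum_(k < n.+1) c k * ((v x - u 0%N) ^+ k - P.[x] ^+ k) = Q.[x].
    under [X in _ + X]eq_bigr do rewrite mulrBr.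
    rewrite sumrB /Q hornerD hornerN !horner_sum.
    under [in RHS]eq_bigr do rewrite hornerZ hornerXn.
    under [X in _ = _ - X]eq_bigr do rewrite hornerZ horner_exp.
    by ring.
  apply: near0_bigO_eq; first by near=> x; exact: QE.
  apply: near0_bigOD; first apply: near0_bigOD.
  - by apply: near0_bigOZ; exact: rem.
  - exact: near0_bigO_comp_taylor.
  - apply: (@near0_bigO_sum _ _ _ (fun k x => c k * ((v x - u 0%N) ^+ k - P.[x] ^+ k))) => k.
    apply/near0_bigOZ/near0_bigO_exprB.
    + exact: near0_bigO_le v1.
    + exact: near0_bigO_horner.
    + apply: near0_bigO_eq (rem _ _ n.+1 vu); near=> x.
      by rewrite PE; ring.
have := near0_bigO_coef QO (ltnSn n); rewrite /Q coefB.
rewrite -(poly_def _ d) coef_poly ltnSn => /subr0_eq ->.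
by rewrite coef_sum; apply: eq_bigr => k _; rewrite coefZ.
Unshelve. all: end_near.
Qed.

Theorem theorem2p3 (K : numFieldType) (hK : complete_archimedean K)
    (N : K -> K) (u : nat -> K) (n : nat)
    (hn : (1 <= n)%N)
    (hN : analytic_at N (u 0%N))
    (hu : \forall lam \near (0 : K), cvgn [series u k * lam ^+ k]_k)
    (hNu : analytic_at (fun lam : K => N (usum u lam)) 0) :
  adomian N n u =
  (n`!%:R)^-1 *
    \sum_(1 <= k < n.+1) bell n k (fun j => j`!%:R * u j) * derive1n k N (u 0%N).
Proof.
have [c Nc] := hN; have [d Nd] := hNu.
have nz : (n`!)%:R != 0 :> K by rewrite pnatr_eq0 -lt0n fact_gt0.
rewrite /adomian (derive1n_power_series n hK Nd) mulKf//.
apply: (canRL (mulKf nz)).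
rewrite (@coef_comp_power_series _ N (usum u) c d u n)//; last first.
  by apply: filterS Nd => x; rewrite subr0.
rewrite -(big_mkord xpredT
  (fun k => c k * ((\sum_(1 <= j < n.+1) u j *: 'X^j) ^+ k)`_n)).
(* The term k = 0 drops out since P^0 = 1 has no coefficient of degree n >= 1. *)
rewrite big_nat_recl// expr0 coef1 gtn_eqF// mulr0 add0r.
rewrite [RHS]big_add1 mulr_sumr; apply: eq_big_nat => k /andP[_ kn].
rewrite (derive1n_power_series k.+1 hK Nc) mulrA bell_coef//.
by rewrite [c _ * _]mulrC mulrA.
Unshelve. all: end_near.
Qed.
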